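(* Let $E$ be a Banach space, and let $v \in E \setminus \{0\}$. Then $E$ is atomic over $v$ (i.e., over the subspace $\mathbb{R}v$) if and only if $v$ is smooth in $E$.
   Context: All spaces are real. Types. For a Banach space $E$ and $n \in \mathbb{N}$, let $E(n) = E \oplus \bigoplus_{i<n} \mathbb{R} x_i$, with formal variables $x_i$. The space of $n$-types $S_n(E)$ is the set of all semi-norms on $E(n)$ extending the norm of $E$; the semi-norm corresponding to $\xi \in S_n(E)$ is written $\|\cdot\|^\xi$. If $E \subseteq F$ are Banach spaces (isometric inclusion) and $\bar a \in F^n$, then $\mathrm{tp}(\bar a/E) \in S_n(E)$ is the semi-norm $b + \sum \lambda_i x_i \mapsto \| b + \sum \lambda_i a_i \|$; $\bar a$ realises $\xi$ if $\xi = \mathrm{tp}(\bar a/E)$. The topology on $S_n(E)$ is the least one making $\xi \mapsto \|x\|^\xi$ continuous for every $x \in E(n)$. The distance $d(\xi,\zeta)$ is the infimum, over all Banach spaces $F \supseteq E$ and all realisations $\bar a,\bar b \in F^n$ of $\xi,\zeta$ respectively, of $\sup_i \|a_i - b_i\|$. A type $\xi$ is isolated if every metric neighbourhood of $\xi$ is also a neighbourhood of $\xi$ in the topology. For $E \subseteq F$, $F$ is atomic over $E$ if the type over $E$ of every finite tuple in $F$ is isolated. A norming linear functional for $v \in E \setminus \{0\}$ is a continuous linear functional $\lambda \in E^*$ with $\|\lambda\|=1$ and $\lambda v = \|v\|$; $v$ is smooth in $E$ if its norming linear functional is unique. *)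

(* Defs.v *)
From HB Require Import structures.
From mathcomp Require Import all_boot all_order all_algebra.
From mathcomp Require Import all_classical all_reals all_analysis.

Set Implicit Arguments.
Unset Strict Implicit.
Unset Printing Implicit Defensive.

Import Order.TTheory GRing.Theory Num.Theory.
Import numFieldNormedType.Exports.

Local Open Scope classical_set_scope.
Local Open Scope ring_scope.

(* Real Banach spaces are [completeNormedModType R] for [R : realType].
   An isometric inclusion E ⊆ F is rendered as a linear isometry E -> F. *)
Record isometric_inclusion (R : realType) (E F : normedModType R) := IsometricInclusion {
  incl :> {linear E -> F} ;
  norm_incl : forall x, `|incl x| = `|x| }.

Section types.
Context {R : realType}.

(* [(b, l) : formal E n] stands for the element b + \sum_(i < n) l_i x_i of
   E(n) = E ⊕ ⊕_(i < n) R x_i, the x_i being formal variables. *)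
Local Notation formal E n := (E * 'rV[R]_n)%type.

Record types (E : completeNormedModType R) (n : nat) := Types {
  type_norm :> formal E n -> R ;
  type_normD : forall x y, type_norm (x + y) <= type_norm x + type_norm y ;
  type_normZ : forall (t : R) x, type_norm (t *: x) = `|t| * type_norm x ;
  type_norm_extends : forall b : E, type_norm (b, 0) = `|b| }.

HB.instance Definition _ E n := gen_eqMixin (types E n).
HB.instance Definition _ E n := gen_choiceMixin (types E n).

(* The least topology on S_n(E) making every evaluation map continuous. *)
HB.instance Definition _ (E : completeNormedModType R) (n : nat) :=
  Topological.copy (types E n)
    (sup_topology (fun x : formal E n =>
      Topological.class (initial_topology (fun xi : types E n => xi x)))).

Section tp.
Variables (E F : completeNormedModType R) (j : isometric_inclusion E F).
Variables (n : nat) (a : 'I_n -> F).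

Definition tp_norm (x : formal E n) : R :=
  `|j x.1 + \sum_(i < n) x.2 ord0 i *: a i|.

Lemma tp_normD x y : tp_norm (x + y) <= tp_norm x + tp_norm y.
Proof.
rewrite /tp_norm; apply: le_trans (ler_normD _ _).
rewrite addrACA -big_split /= linearD /= le_eqVlt; apply/orP; left; apply/eqP.
by congr (`|_ + _|); apply: eq_bigr => i _; rewrite mxE scalerDl.
Qed.

Lemma tp_normZ (t : R) x : tp_norm (t *: x) = `|t| * tp_norm x.
Proof.
rewrite /tp_norm -normrZ scalerDr scaler_sumr /= linearZ /=.
by congr (`|_ + _|); apply: eq_bigr => i _; rewrite mxE scalerA.
Qed.

Lemma tp_norm_extends (b : E) : tp_norm (b, 0) = `|b|.
Proof.
rewrite /tp_norm /= big1 ?addr0 ?norm_incl// => i _.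
by rewrite mxE scale0r.
Qed.

Definition tp : types E n := Types tp_normD tp_normZ tp_norm_extends.

End tp.

Section atomic.
Local Open Scope ereal_scope.

(* The infimum is taken in \bar R, so that no default value is involved. The
   sup over the empty index set, when n = 0, is 0. *)
Definition type_dist (E : completeNormedModType R) (n : nat)
    (xi zeta : types E n) : \bar R :=
  ereal_inf [set r : \bar R |
    exists (F : completeNormedModType R) (j : isometric_inclusion E F)
           (a b : 'I_n -> F),
      [/\ tp j a = xi, tp j b = zeta &
          r = (\big[Num.max/0%R]_(i < n) `|a i - b i|%R)%:E]].

Definition metric_nbhs (E : completeNormedModType R) (n : nat)
    (xi : types E n) (U : set (types E n)) : Prop :=
  exists2 r : R, (0 < r)%R & [set zeta | type_dist xi zeta < r%:E] `<=` U.

Definition isolated_type (E : completeNormedModType R) (n : nat)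
    (xi : types E n) : Prop :=
  forall U : set (types E n), metric_nbhs xi U -> nbhs xi U.

Definition atomic_over (E F : completeNormedModType R)
    (j : isometric_inclusion E F) : Prop :=
  forall (n : nat) (a : 'I_n -> F), isolated_type (tp j a).

End atomic.

End types.

(* The subspace R v of E, as a Banach space with the norm inherited from E. *)
Section line.
Context {R : realType} {E : completeNormedModType R}.

Definition in_line (v : E) : {pred E} := [pred x | `[< exists t : R, x = t *: v >]].

Fact in_line_submod_closed v : submod_closed (in_line v).
Proof.
split=> [|t x y /asboolP[p ->] /asboolP[q ->]]; apply/asboolP.
  by exists 0; rewrite scale0r.
by exists (t * p + q); rewrite scalerDl scalerA.
Qed.

HB.instance Definition _ v :=
  GRing.isSubmodClosed.Build R E (in_line v) (in_line_submod_closed v).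

Record line (v : E) := Line { line_val :> E ; _ : line_val \in in_line v }.

HB.instance Definition _ v := [isSub for @line_val v].
HB.instance Definition _ v := [Choice of line v by <:].
HB.instance Definition _ v := [SubChoice_isSubLmodule of line v by <:].

Section norm.
Variable v : E.
Let N (x : line v) : R := `|val x|.

Let N_D x y : N (x + y) <= N x + N y.
Proof. by rewrite /N raddfD ler_normD. Qed.

Let N_Z (t : R) x : N (t *: x) = `|t| * N x.
Proof. by rewrite /N linearZ normrZ. Qed.

Let N_eq0 x : N x = 0 -> x = 0.
Proof. by move=> /normr0_eq0 x0; apply: val_inj; rewrite x0 raddf0. Qed.

HB.instance Definition _ := Lmodule_isNormed.Build R (line v) N_D N_Z N_eq0.

Lemma norm_line (x : line v) : `|x| = `|val x|. Proof. by []. Qed.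

Lemma line_complete (F : set_system (line v)) :
  ProperFilter F -> cauchy F -> cvg F.
Proof.
move=> FF /cauchy_ballP Fc; have [v0|v0] := eqVneq v 0.
  apply/cvg_ex; exists 0 => A A0; have -> : A = setT; last exact: filterT.
  apply/seteqP; split=> // x _; have -> : x = 0; last exact: nbhs_singleton A0.
  apply: val_inj; rewrite raddf0; case: x => x /= /asboolP[t ->].
  by rewrite v0 scaler0.
have nv : 0 < `|v| by rewrite normr_gt0.
have /choice[c cE] : forall x : line v, exists t, val x = t *: v.
  by case=> x /= /asboolP.
have : cauchy (c @ F); last move=> /R_complete /cvg_ex[l cl].
  apply/cauchy_ballP => e e0; have Fe := Fc _ (mulr_gt0 e0 nv).
  suff : \forall x & y \near F, ball (c x) e (c y).
    by move=> H; rewrite (near_map2 c c (fun x y => ball x e y)).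
  apply: filterS Fe => -[x y] /=.
  rewrite -!ball_normE /= norm_line raddfB /= !cE -scalerBl normrZ.
  by rewrite ltr_pM2r.
have lv : l *: v \in in_line v by apply/asboolP; exists l.
apply/cvg_ex; exists (Line lv); apply/cvgrPdist_lt => e e0.
have /cvgrPdist_lt/(_ _ (divr_gt0 e0 nv)) := cl.
apply: filterS => x /=; rewrite norm_line raddfB /= cE -scalerBl normrZ.
by rewrite ltr_pdivlMr.
Qed.

HB.instance Definition _ := Uniform_isComplete.Build (line v) line_complete.

End norm.

Definition line_incl (v : E) : isometric_inclusion (line v) E :=
  @IsometricInclusion R (line v) E (val : line v -> E) (fun=> erefl).

End line.

Section smooth.
Context {R : realType} {E : completeNormedModType R}.

Definition dual_norm (lam : E -> R) : R :=
  sup [set `|lam x| | x in [set x : E | `|x| <= 1]].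

Definition norming_functional (v : E) (lam : E -> R) : Prop :=
  [/\ scalar lam, continuous lam, dual_norm lam = 1 & lam v = `|v|].

Definition smooth (v : E) : Prop := exists! lam : E -> R, norming_functional v lam.

End smooth.

(* Main.v *)
Require Import Defs.
From mathcomp Require Import all_boot all_order all_algebra.
From mathcomp Require Import all_classical all_reals all_analysis.
From HB Require Import structures.
From mathcomp Require Import lra ring.
Import Order.TTheory GRing.Theory Num.Theory.
Import numFieldNormedType.Exports.
Local Open Scope ring_scope.

(** Smoothness at [v] is a statement about the behaviour of [`|t *: v + x|] for
    large [t].  By convexity [`|t *: v + x| - t * `|v|] decreases to a limit
    [q x], and [q] is sublinear; the linear functionals below [q] are the
    norming functionals of [v], and each [q x] is attained by one of them.  So
    [v] is smooth exactly when [q] is linear, that is, when the two slopes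
    [q x] and [- q (- x)] agree for all [x].

    If [v] is smooth, then a type [zeta] over [R v] which agrees up to [e] with
    [xi] at [T v + x] and at [T v - x], with [T] large, agrees with it up to
    [2 * e], say, at [t v + x] for all [t] with [T <= `|t|]: for such [t] the
    triangle inequality leaves [zeta (t v + x)] no more freedom than the
    difference of the two slopes ([near_line]).  The remaining [t], and the
    coefficients of the variables in [x], range over compact sets, so a
    topological neighbourhood of [xi] controls [`|xi x - zeta x|] uniformly
    ([near_close]).  Uniform closeness of semi-norms is metric closeness of types
    ([type_dist_le]): one amalgamates realisations of [xi] and [zeta] inside the
    space of bounded functions on the set of pairs of functionals [f <= xi],
    [g <= zeta] that nearly agree.  That enough such pairs exist is a
    Hahn-Banach statement, in the form of the Mazur-Orlicz theorem
    ([mazur_orlicz]).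

    If [v] is not smooth, it has norming functionals [f] and [g] with
    [f w < g w] for some [w].  With [xi] the type of [w], the types
    [max (c * xi) `|f|], for [c < 1], converge to [xi] pointwise as [c] tends to
    [1].  But far out on the line [t v + w] the value of such a type is
    [t * `|v| + f w], whereas [xi] is at least [t * `|v| + g w] there; hence the
    distance to [xi] does not tend to [0] ([not_isolated]). *)

(** * Sublinear functionals *)

Section sublinear.
Set Implicit Arguments.
Unset Strict Implicit.
Local Open Scope classical_set_scope.
Context {R : realType} {V : lmodType R}.
Implicit Types (p q : V -> R) (C : V -> R -> Prop) (x y : V).

(** The inequality in the second clause forces equality when [0 < t]. *)
Definition sublinear p : Prop :=
  (forall x y, p (x + y) <= p x + p y) /\
  (forall t x, 0 <= t -> p (t *: x) <= t * p x).

Lemma sublinear0 p : sublinear p -> p 0 = 0.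
Proof.
move=> [pD pZ]; apply/eqP; rewrite eq_le; apply/andP; split.
  by have := pZ 0 0 (lexx 0); rewrite scale0r mul0r.
by have := pD 0 0; rewrite addr0 lerDl.
Qed.

Lemma sublinear_oppl p : sublinear p -> forall x, - p (- x) <= p x.
Proof.
move=> ps x; rewrite lerNl -subr_ge0 opprK addrC.
by have := ps.1 x (- x); rewrite subrr (sublinear0 ps).
Qed.

Lemma sublinear_linear p : sublinear p -> (forall x, p (- x) <= - p x) -> scalar p.
Proof.
move=> ps pN'; have pN x : p (- x) = - p x.
  apply/eqP; rewrite eq_le pN'/=.
  by have := sublinear_oppl ps (- x); rewrite opprK.
have pD x y : p (x + y) = p x + p y.
  apply/eqP; rewrite eq_le ps.1 /= -lerN2 -pN !opprD -!pN; exact: ps.1.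
have pZ t x : 0 <= t -> p (t *: x) = t * p x.
  move=> t0; apply/eqP; rewrite eq_le ps.2//= -lerN2 -pN -mulrN -pN -scalerN.
  exact: ps.2.
move=> t x y; rewrite pD; congr (_ + _); have [t0|/ltW t0] := leP 0 t; first exact: pZ.
by rewrite -{1}[t]opprK scaleNr pN pZ ?oppr_ge0// mulNr opprK.
Qed.

(** [C] is a convex cone in [V * R] lying below the graph of [p]: the data of
    a superlinear function on a cone of [V], without naming its domain. *)
Definition cone_below C p : Prop :=
  [/\ C 0 0,
      forall x y r s, C x r -> C y s -> C (x + y) (r + s),
      forall t x r, 0 < t -> C x r -> C (t *: x) (t * r) &
      forall x r, C x r -> r <= p x].

Section lowering.
Variables (C : V -> R -> Prop) (p : V -> R).
Hypotheses (ps : sublinear p) (Cp : cone_below C p).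

Let values x : set R := [set s | exists w r, C w r /\ s = p (x + w) - r].

(** The infimal convolution of [p] with [C]: the largest sublinear functional
    below [p] whose linear minorants lie above [C]. *)
Definition lowering x : R := inf (values x).

Let values_neq0 x : values x !=set0.
Proof. by case: Cp => C0 _ _ _; exists (p (x + 0) - 0), 0, 0. Qed.

Let values_lb x : lbound (values x) (- p (- x)).
Proof.
case: Cp => _ _ _ Cle _ [w [r [Cwr ->]]].
have := ps.1 (x + w) (- x); rewrite addrAC subrr add0r => pw.
by have := Cle _ _ Cwr; lra.
Qed.

Lemma lowering_le x w r : C w r -> lowering x <= p (x + w) - r.
Proof.
by move=> Cwr; apply: ge_inf; [exists (- p (- x)); exact: values_lb|exists w, r].
Qed.

Lemma le_lowering x c :
  (forall w r, C w r -> c <= p (x + w) - r) -> c <= lowering x.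
Proof.
by move=> cle; apply: lb_le_inf => // _ [w [r [Cwr ->]]]; exact: cle.
Qed.

Lemma lowering_lt x e : 0 < e ->
  exists w r, C w r /\ p (x + w) - r < lowering x + e.
Proof.
move=> e0; have [|s [w [r [Cwr ->]]] lt_s] := inf_adherent (E := values x) e0.
  by split=> //; exists (- p (- x)); exact: values_lb.
by exists w, r.
Qed.

Lemma lowering_le_id x : lowering x <= p x.
Proof.
by case: Cp => C0 _ _ _; have := lowering_le x C0; rewrite addr0 subr0.
Qed.

Lemma lowering_sublinear : sublinear lowering.
Proof.
case: Cp => C0 CD CZ _; split=> [x y|t x].
  suff: lowering (x + y) - lowering y <= lowering x by lra.
  apply: le_lowering => w r Cwr.
  suff: lowering (x + y) - (p (x + w) - r) <= lowering y by lra.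
  apply: le_lowering => z s Czs.
  have := lowering_le (x + y) (CD _ _ _ _ Cwr Czs); rewrite addrACA.
  by have := ps.1 (x + w) (y + z); lra.
rewrite le_eqVlt => /orP[/eqP <-|t0].
  by rewrite scale0r mul0r -(sublinear0 ps) lowering_le_id.
rewrite mulrC -ler_pdivrMr//; apply: le_lowering => w r Cwr.
rewrite ler_pdivrMr//; apply: le_trans (lowering_le _ (CZ _ _ _ t0 Cwr)) _.
by rewrite -scalerDr; have := ps.2 t (x + w) (ltW t0); lra.
Qed.

End lowering.

(** A linear functional lies above this cone when its value at [x] is at least
    [c]. *)
Definition ray x c : V -> R -> Prop :=
  fun w r => exists t, [/\ 0 <= t, w = t *: x & r = t * c].

Lemma ray_below p x : sublinear p -> cone_below (ray x (p x)) p.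
Proof.
move=> ps; split=> [|_ _ _ _ [t [t0 -> ->]] [s [s0 -> ->]]
  |t _ _ t0 [s [s0 -> ->]]|_ _ [t [t0 -> ->]]].
- by exists 0; rewrite scale0r mul0r.
- by exists (t + s); rewrite addr_ge0// scalerDl mulrDl.
- by exists (t * s); rewrite mulr_ge0// ?ltW// scalerA mulrA.
- have [->|tN0] := eqVneq t 0; first by rewrite mul0r scale0r sublinear0.
  have ti0 : 0 <= t^-1 by rewrite invr_ge0.
  have := ps.2 _ (t *: x) ti0; rewrite scalerA mulVf// scale1r.
  by rewrite mulrC ler_pdivlMr 1?mulrC// lt_neqAle eq_sym tN0.
Qed.

Lemma ray_ray x c : ray x c x c.
Proof. by exists 1; rewrite scale1r mul1r. Qed.

(** A minimal sublinear functional is linear: lowering it along the ray of its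
    own values at [x] must not change it, which gives [q (- x) <= - q x].
    Minimal functionals below [p] exist by Zorn, the infimum of a chain being
    sublinear and bounded below by [- p (- x)]. *)
Lemma hahn_banach p : sublinear p -> exists f : {scalar V}, forall x, f x <= p x.
Proof.
move=> ps; pose T := {q | sublinear q /\ forall x, q x <= p x}.
pose mkT q qs qp : T := exist _ q (conj qs qp).
(* Larger in this order means pointwise smaller, so that maximal elements are
   minimal functionals. *)
pose le_T (q q' : T) := `[< forall x, sval q' x <= sval q x >].
have [||||[q [qs qp]] qmin] := @Zorn T le_T.
- by move=> q; apply/asboolP.
- move=> q1 q2 q3 /asboolP h /asboolP h'; apply/asboolP => x.
  exact: le_trans (h' x) (h x).
- move=> q1 q2 /asboolP h /asboolP h'; apply: eq_sig_hprop => [q|].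
    exact: Prop_irrelevance.
  by apply/funext => x; apply/eqP; rewrite eq_le h h'.
- move=> A Atot; have [A0|/set0P[q0 Aq0]] := eqVneq A set0.
    by exists (mkT _ ps (fun x => lexx (p x))) => q; rewrite A0.
  pose vals x := [set sval q x | q in A]; pose m x := inf (vals x).
  have vlb x : has_lbound (vals x).
    exists (- p (- x)) => _ [[q [qs qp]] _ <-] /=.
    by apply: le_trans (sublinear_oppl qs x); rewrite lerN2.
  have v0 x : vals x !=set0 by exists (sval q0 x), q0.
  have m_le (q : T) x : A q -> m x <= sval q x
    by move=> Aq; apply: ge_inf => //; exists q.
  have ms : sublinear m.
    split=> [x y|t x].
      suff: m (x + y) - m y <= m x by lra.
      apply: lb_le_inf => // _ [q1 Aq1 <-].
      suff: m (x + y) - sval q1 x <= m y by lra.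
      apply: lb_le_inf => // _ [q2 Aq2 <-].
      (* The smaller of [q1] and [q2] bounds both summands. *)
      have [/asboolP h|/asboolP h] := Atot _ _ Aq1 Aq2.
        by have := m_le _ (x + y) Aq2; have := (svalP q2).1.1 x y; have := h x; lra.
      by have := m_le _ (x + y) Aq1; have := (svalP q1).1.1 x y; have := h y; lra.
    rewrite le_eqVlt => /orP[/eqP <-|t0].
      rewrite scale0r mul0r -(sublinear0 (svalP q0).1); exact: m_le.
    rewrite mulrC -ler_pdivrMr//; apply: lb_le_inf => // _ [q1 Aq1 <-].
    rewrite ler_pdivrMr// mulrC; apply: le_trans (m_le _ _ Aq1) _.
    by apply: (svalP q1).1.2; exact: ltW.
  have mp x : m x <= p x by apply: le_trans (m_le _ _ Aq0) _; exact: (svalP q0).2.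
  by exists (mkT _ ms mp) => q Aq; apply/asboolP => x; exact: m_le.
have ql : scalar q.
  apply: sublinear_linear => // x.
  have Cq := ray_below x qs.
  have lp y : lowering (ray x (q x)) q y <= p y.
    exact: le_trans (lowering_le_id qs Cq y) (qp y).
  have lq : lowering (ray x (q x)) q = q.
    apply: (congr1 sval (qmin (mkT _ (lowering_sublinear qs Cq) lp) _)).
    by apply/asboolP => y; exact: lowering_le_id.
  rewrite -{1}lq.
  by have := lowering_le qs Cq (- x) (ray_ray _ _); rewrite addNr sublinear0// sub0r.
pose f : {scalar V} := HB.pack q (GRing.isLinear.Build R V R *%R q ql).
by exists f.
Qed.

(** Any linear functional below the lowering of [p] by [C] will do: at [- x]
    the lowering is at most [p (- x + x) - r = - r]. *)
Lemma mazur_orlicz p C : sublinear p -> cone_below C p ->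
  exists f : {scalar V}, (forall x, f x <= p x) /\ forall x r, C x r -> r <= f x.
Proof.
move=> ps Cp; have [f fle] := hahn_banach (lowering_sublinear ps Cp).
exists f; split=> [x|x r Cxr]; first exact: le_trans (lowering_le_id ps Cp x).
have := le_trans (fle (- x)) (lowering_le ps Cp (- x) Cxr).
by rewrite addNr sublinear0// linearN /=; lra.
Qed.

Lemma norming_exists p x : sublinear p ->
  exists f : {scalar V}, (forall y, f y <= p y) /\ f x = p x.
Proof.
move=> ps; have [f [fle /(_ _ _ (ray_ray _ _)) le_fx]] :=
  mazur_orlicz ps (ray_below x ps).
by exists f; split=> //; apply/eqP; rewrite eq_le fle.
Qed.

End sublinear.

(** * The Banach space of bounded functions *)

Section bounded_functions.
Set Implicit Arguments.
Unset Strict Implicit.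
Local Open Scope classical_set_scope.
Context {R : realType} {I : Type}.

Definition is_bounded : {pred I -> R^o} :=
  [pred f | `[< exists M, forall i, `|f i| <= M >]].

Fact is_bounded_submod_closed : submod_closed is_bounded.
Proof.
split=> [|t f g /asboolP[M fM] /asboolP[N gN]]; apply/asboolP.
  by exists 0 => i; rewrite normr0.
exists (`|t| * M + N) => i; apply: le_trans (ler_normD _ _) _.
by rewrite lerD// normrM ler_wpM2l.
Qed.

HB.instance Definition _ :=
  GRing.isSubmodClosed.Build R (I -> R^o) is_bounded is_bounded_submod_closed.

Record bounded := Bounded { bounded_val :> I -> R^o ; _ : bounded_val \in is_bounded }.

HB.instance Definition _ := [isSub for @bounded_val].
HB.instance Definition _ := [Choice of bounded by <:].
HB.instance Definition _ := [SubChoice_isSubLmodule of bounded by <:].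

Definition sup_norm (f : bounded) : R := sup (range (fun i => `|f i|)).

Implicit Types f g : bounded.

Lemma sup_norm_ge f i : `|f i| <= sup_norm f.
Proof.
apply: ub_le_sup; last by exists i.
by case: f => f /= /asboolP[M fM]; exists M => _ [j _ <-]; exact: fM.
Qed.

Lemma sup_norm_le f M : 0 <= M -> (forall i, `|f i| <= M) -> sup_norm f <= M.
Proof.
move=> M0 fM; rewrite /sup_norm.
have [->|/set0P ne] := eqVneq (range (fun i => `|f i|)) set0.
  by rewrite sup0.
by apply: ge_sup => // _ [i _ <-]; exact: fM.
Qed.

Lemma sup_norm_ge0 f : 0 <= sup_norm f.
Proof.
rewrite /sup_norm; have [->|/set0P [_ [i _ _]]] := eqVneq (range (fun i => `|f i|)) set0.
  by rewrite sup0.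
by apply: le_trans (sup_norm_ge f i).
Qed.

Fact sup_normD f g : sup_norm (f + g) <= sup_norm f + sup_norm g.
Proof.
apply: sup_norm_le => [|i]; first by rewrite addr_ge0 ?sup_norm_ge0.
by apply: le_trans (ler_normD _ _) _; rewrite lerD ?sup_norm_ge.
Qed.

Fact sup_normZ (t : R) f : sup_norm (t *: f) = `|t| * sup_norm f.
Proof.
have le_Z s g : sup_norm (s *: g) <= `|s| * sup_norm g.
  apply: sup_norm_le => [|i]; first by rewrite mulr_ge0 ?sup_norm_ge0.
  by rewrite normrM ler_wpM2l ?sup_norm_ge.
apply/eqP; rewrite eq_le le_Z /=; have [->|t0] := eqVneq t 0.
  by rewrite normr0 mul0r sup_norm_ge0.
rewrite -ler_pdivlMl ?normr_gt0// -normfV.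
by have := le_Z t^-1 (t *: f); rewrite scalerA mulVf// scale1r.
Qed.

Fact sup_norm_eq0 f : sup_norm f = 0 -> f = 0.
Proof.
move=> f0; apply: val_inj; apply/funext => i; apply/eqP.
by rewrite -normr_le0 -f0 sup_norm_ge.
Qed.

HB.instance Definition _ :=
  Lmodule_isNormed.Build R bounded sup_normD sup_normZ sup_norm_eq0.

(** A Cauchy filter converges pointwise, and the Cauchy condition, being uniform
    in the point, passes to the limit. *)
Lemma bounded_complete (F : set_system bounded) :
  ProperFilter F -> cauchy F -> cvg F.
Proof.
move=> FF /cauchy_ballP Fc.
have Fi (e : R) : 0 < e ->
    \forall f & g \near F, forall i, `|(f : bounded) i - (g : bounded) i| < e.
  move=> e0; apply: filterS (Fc _ e0) => -[f g] /=.
  rewrite -ball_normE /= => fg i.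
  exact: le_lt_trans (sup_norm_ge (f - g) i) fg.
have /choice[l lE] : forall i, exists l : R, (fun f : bounded => f i : R) @ F --> l.
  move=> i; pose c (f : bounded) : R := f i.
  suff: cauchy (c @ F) by move=> /R_complete /cvg_ex.
  apply/cauchy_ballP => e e0.
  suff : \forall f & g \near F, ball (c f) e (c g).
    by move=> H; rewrite (near_map2 c c (fun x y => ball x e y)).
  by apply: filterS (Fi _ e0) => -[f g] /= /(_ i); rewrite -ball_normE.
have lF (e : R) : 0 < e -> \forall f \near F, forall i, `|l i - (f : bounded) i| <= e.
  move=> e0; have [[A B] /= [FA FB] AB] := Fi _ e0.
  apply: filterS FA => f Af i; apply/ler_addgt0Pr => d d0.
  have Fl : \forall g \near F, `|l i - (g : bounded) i| < d.
    by move/cvgrPdist_lt: (lE i) => /(_ d d0).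
  have [g [/= lg Bg]] := filter_ex (filterI Fl FB).
  have /(_ i) := AB (f, g) (conj Af Bg); rewrite distrC => /= fg.
  by have := ler_distD (g i) (l i) (f i); lra.
have lb : l \in is_bounded.
  have [f lf] := filter_ex (lF 1 ltr01); apply/asboolP.
  exists (1 + sup_norm f) => i.
  rewrite -[l i](subrK (f i)) (le_trans (ler_normD _ _))//.
  by rewrite lerD ?sup_norm_ge.
apply/cvg_ex; exists (Bounded lb); apply/cvgrPdist_le => e e0.
apply: filterS (lF _ e0) => f lf; apply: sup_norm_le => //; exact: ltW.
Qed.

HB.instance Definition _ := Uniform_isComplete.Build bounded bounded_complete.

End bounded_functions.
Arguments bounded R I : clear implicits.

(** * The distance between types *)

Section types_theory.
Set Implicit Arguments.
Unset Strict Implicit.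
Local Open Scope classical_set_scope.
Context {R : realType} {E : completeNormedModType R} {n : nat}.
Local Notation formal := (E * 'rV[R]_n)%type.
Implicit Types (xi zeta : types E n) (x y : formal).

Definition formal_var (i : 'I_n) : formal := (0, delta_mx 0 i).

Lemma formal_decomp x : x = (x.1, 0) + \sum_(i < n) x.2 ord0 i *: formal_var i.
Proof.
apply: injective_projections => /=.
  rewrite (raddf_sum fst) big1 ?addr0// => i _; by rewrite /= scaler0.
by rewrite (raddf_sum snd) add0r {1}(row_sum_delta x.2).
Qed.

Lemma types_eq xi zeta : (forall x, xi x = zeta x) -> xi = zeta.
Proof.
case: xi zeta => [f f1 f2 f3] [g g1 g2 g3] /= /funext fg; subst g.
by congr Types; exact: Prop_irrelevance.
Qed.

Lemma types_sublinear xi : sublinear xi.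
Proof. by split=> [|t x t0]; [exact: type_normD|rewrite type_normZ ger0_norm]. Qed.

Lemma typesN xi x : xi (- x) = xi x.
Proof. by rewrite -scaleN1r type_normZ normrN1 mul1r. Qed.

Lemma types_ge0 xi x : 0 <= xi x.
Proof.
have := type_normD xi x (- x).
by rewrite subrr typesN (sublinear0 (types_sublinear xi)); lra.
Qed.

Lemma types_scalar_norm xi (f : {scalar formal}) x :
  (forall y, f y <= xi y) -> `|f x| <= xi x.
Proof. by move=> fxi; rewrite ler_norml fxi andbT lerNl -linearN -typesN fxi. Qed.

Lemma norm_delta_le1 (i : 'I_n) : `|delta_mx 0 i : 'rV[R]_n| <= 1.
Proof.
rewrite [leLHS]/Num.norm /= mx_normrE; apply/bigmax_leP; split=> //= -[a b] _ /=.
by rewrite mxE; case: (_ && _); rewrite ?normr1 ?normr0.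
Qed.

(** A family [phi] of functionals below [xi] that attains every value of [xi]
    represents [xi] in the space of bounded functions on the index set: each
    formal vector is sent to its evaluation map. *)
Section evaluation.
Variables (I : Type) (phi : I -> {scalar formal}) (xi : types E n).
Hypothesis phi_le : forall i x, phi i x <= xi x.

Fact evaluation_bounded x : (fun i => phi i x : R^o) \in is_bounded.
Proof. by apply/asboolP; exists (xi x) => i; exact: types_scalar_norm. Qed.

Definition evaluation x : bounded R I := Bounded (evaluation_bounded x).

Fact evaluation_is_linear : linear evaluation.
Proof. by move=> t x y; apply: val_inj; apply/funext => i /=; rewrite linearP. Qed.

HB.instance Definition _ :=
  GRing.isLinear.Build R formal (bounded R I) *:%R evaluation evaluation_is_linear.

Hypothesis phi_norming : forall x, exists i, phi i x = xi x.

Lemma norm_evaluation x : `|evaluation x| = xi x.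
Proof.
apply/eqP; rewrite eq_le; apply/andP; split.
  by apply: sup_norm_le => [|i]; [exact: types_ge0|exact: types_scalar_norm].
have [i <-] := phi_norming x.
exact: le_trans (ler_norm _) (sup_norm_ge (evaluation x) i).
Qed.

Lemma tp_evaluation (j : isometric_inclusion E (bounded R I)) :
  (forall b, j b = evaluation (b, 0)) ->
  tp j (fun i => evaluation (formal_var i)) = xi.
Proof.
move=> jE; apply: types_eq => x /=; rewrite /tp_norm jE -norm_evaluation.
congr `|_|; rewrite [in RHS](formal_decomp x) linearD linear_sum /=; congr (_ + _).
by apply: eq_bigr => i _; rewrite linearZ.
Qed.

End evaluation.

Definition close_types xi zeta (e : R) := forall x, `|xi x - zeta x| <= e * `|x.2|.

Lemma close_types_sym xi zeta e : close_types xi zeta e -> close_types zeta xi e.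
Proof. by move=> h x; rewrite distrC. Qed.

(** Sandwiching the superlinear function [f - e * `|snd|] under the sublinear
    [zeta] makes [g] lie above the former, and evaluating at [- x] gives the other
    half of the estimate. *)
Lemma close_types_scalar xi zeta e (f : {scalar formal}) :
  0 <= e -> close_types xi zeta e -> (forall x, f x <= xi x) ->
  exists g : {scalar formal},
    (forall x, g x <= zeta x) /\ forall x, `|f x - g x| <= e * `|x.2|.
Proof.
move=> e0 close fxi.
have [|g [gzeta fg]] := @mazur_orlicz _ _ zeta (fun w r => r <= f w - e * `|w.2|)
    (types_sublinear zeta).
  split=> [|x y r s /= xr ys|t x r t0 /= xr|x r /= xr].
  - by rewrite linear0 normr0 mulr0 subr0.
  - rewrite linearD /=; have := ler_wpM2l e0 (ler_normD x.2 y.2); lra.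
  - rewrite linearZ /= normrZ gtr0_norm// mulrCA -mulrBr.
    by rewrite ler_wpM2l// ltW.
  - by have := fxi x; have := close x; rewrite ler_norml => /andP[]; lra.
exists g; split=> // x; rewrite ler_norml.
have := fg x _ (lexx _); have := fg (- x) _ (lexx _).
by rewrite !linearN /= normrN; lra.
Qed.

(** The amalgam of [xi] and [zeta] is built on the set [I] of pairs of nearby
    functionals: variables are realised through the first component for [xi] and
    through the second for [zeta].  Nearby functionals agree on [E], so both
    realisations extend the same embedding of [E], and corresponding variables are
    within [e].  Working with functionals avoids quotients and completions. *)
Lemma type_dist_le xi zeta (e : R) :
  0 <= e -> close_types xi zeta e -> (type_dist xi zeta <= e%:E)%E.
Proof.
move=> e0 close.
pose I := {fg : {scalar formal} * {scalar formal} |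
  [/\ forall x, fg.1 x <= xi x, forall x, fg.2 x <= zeta x &
      forall x, `|fg.1 x - fg.2 x| <= e * `|x.2|]}.
have le_xi (i : I) x : (sval i).1 x <= xi x by case: i => ? [].
have le_zeta (i : I) x : (sval i).2 x <= zeta x by case: i => ? [].
have le_e (i : I) x : `|(sval i).1 x - (sval i).2 x| <= e * `|x.2| by case: i => ? [].
have norm_xi x : exists i : I, (sval i).1 x = xi x.
  have [f [fxi fx]] := norming_exists x (types_sublinear xi).
  have [g [gzeta fg]] := close_types_scalar e0 close fxi.
  by exists (exist _ (f, g) (And3 fxi gzeta fg)).
have norm_zeta x : exists i : I, (sval i).2 x = zeta x.
  have [g [gzeta gx]] := norming_exists x (types_sublinear zeta).
  have [f [fxi gf]] := close_types_scalar e0 (close_types_sym close) gzeta.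
  have fg y : `|f y - g y| <= e * `|y.2| by rewrite distrC.
  by exists (exist _ (f, g) (And3 fxi gzeta fg)).
pose a := evaluation le_xi; pose b := evaluation le_zeta.
pose j0 (x : E) := a (x, 0).
have j0_linear : linear j0.
  by move=> t x y; rewrite /j0 -linearP; congr (a _);
    apply: injective_projections; rewrite //= scaler0 addr0.
pose j1 : {linear E -> bounded R I} :=
  HB.pack j0 (GRing.isLinear.Build R E (bounded R I) *:%R j0 j0_linear).
have j_norm (x : E) : `|j1 x| = `|x|.
  by rewrite -(type_norm_extends xi) -(norm_evaluation le_xi norm_xi).
pose j := IsometricInclusion j_norm.
have jb (x : E) : j x = b (x, 0).
  apply: val_inj; apply/funext => i /=; apply/eqP; rewrite -subr_eq0 -normr_le0.
  by have := le_e i (x, 0); rewrite normr0 mulr0.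
apply: (@le_trans _ _
    (\big[Num.max/0]_(i < n) `|a (formal_var i) - b (formal_var i)|)%:E).
  apply: ereal_inf_lbound; exists (bounded R I : completeNormedModType R), j,
    (fun i => a (formal_var i)), (fun i => b (formal_var i)).
  split=> //; first exact: (tp_evaluation norm_xi).
  exact: (tp_evaluation norm_zeta).
rewrite lee_fin; apply/bigmax_leP; split=> // i _; apply: sup_norm_le => // k.
apply: le_trans (le_e k (formal_var i)) _.
by rewrite ler_piMr ?norm_delta_le1.
Qed.

(** Replacing the realisation [a] by [b] moves the vector with coefficients
    [l i] by at most the sum of the [`|l i| * `|a i - b i|]. *)
Lemma type_dist_lt_le xi zeta (r : R) x : (type_dist xi zeta < r%:E)%E ->
  xi x - zeta x <= r * \sum_(i < n) `|x.2 ord0 i|.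
Proof.
move=> /ereal_inf_lt[_ [F [j [a [b [<- <- ->]]]]]]; rewrite lte_fin => ab.
rewrite /= /tp_norm; apply: le_trans (lerB_dist _ _) _.
rewrite opprD addrACA subrr add0r -sumrB mulr_sumr.
apply: le_trans (ler_norm_sum _ _ _) _; apply: ler_sum => i _.
rewrite -scalerBr normrZ mulrC ler_wpM2r//.
by apply: le_trans (ltW ab); apply: le_bigmax_cond.
Qed.

End types_theory.

(** * The topology on types *)

Section types_topology.
Set Implicit Arguments.
Unset Strict Implicit.
Local Open Scope classical_set_scope.
Context {R : realType} {E : completeNormedModType R} {n : nat}.
Local Notation formal := (E * 'rV[R]_n)%type.
Implicit Types (xi zeta : types E n) (x y : formal).

Lemma types_cvg (F : set_system (types E n)) xi : Filter F ->
  F --> xi <-> forall x, (type_norm zeta x @[zeta --> F]) --> xi x.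
Proof.
move=> FF; split=> [/cvg_sup cF x|cF].
  exact: cvg_trans (cvg_app _ (cF x)) (@initial_continuous _ _ _ _).
apply/cvg_sup => x A /= [_ [[B Bop <-] Bx] BA].
by rewrite nbhs_filterE; apply: filterS BA _; apply: (cF x); exact: open_nbhs_nbhs.
Qed.

Lemma near_eval xi x (e : R) : 0 < e ->
  \forall zeta \near xi, `|xi x - type_norm zeta x| < e.
Proof.
move=> e0; have /types_cvg/(_ x)/cvgrPdist_lt/(_ e e0) := @cvg_id _ (nbhs xi).
exact.
Qed.

Lemma types_lipschitz xi x y : `|xi x - xi y| <= xi (x - y).
Proof.
have := type_normD xi (x - y) y; have := type_normD xi (y - x) x.
by rewrite !subrK -opprB typesN ler_norml; lra.
Qed.

End types_topology.

(** * Isolation of flat types *)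

Section flatness.
Set Implicit Arguments.
Unset Strict Implicit.
Local Open Scope classical_set_scope.
Context {R : realType} {E : completeNormedModType R} {n : nat}.
Local Notation formal := (E * 'rV[R]_n)%type.
Variables (xi : types E n) (b : E).
Implicit Types (zeta : types E n) (x y : formal) (t T : R).

Let u : formal := (b, 0).

Let normu zeta t : zeta (t *: u) = `|t| * `|b|.
Proof. by rewrite type_normZ type_norm_extends. Qed.

(** All types share the Lipschitz constant [`|b|] in the variable [t], so
    closeness at one [t0] spreads to a neighbourhood of [t0] independent of the
    type, and compactness of the segment applies. *)
Lemma near_segment x T e : 0 < e ->
  \forall zeta \near xi, forall t, - T <= t <= T ->
    `|xi (t *: u + x) - type_norm zeta (t *: u + x)| <= e.
Proof.
move=> e0; pose P zeta t := `|xi (t *: u + x) - type_norm zeta (t *: u + x)| <= e.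
suff: \forall zeta \near xi, `[- T, T] `<=` P zeta.
  by apply: filterS => zeta segP t tT; apply: segP; rewrite /= in_itv.
have /compact_near_coveringP cover := @segment_compact R (- T) T.
apply: (cover _ (nbhs xi) P).
move=> t0 _; pose d := e / (4 * (`|b| + 1)).
have b0 : 0 < `|b| + 1 by rewrite ltr_wpDl.
have d0 : 0 < d by rewrite divr_gt0// mulr_gt0.
exists ([set t | `|t0 - t| < d],
        [set zeta | `|xi (t0 *: u + x) - type_norm zeta (t0 *: u + x)| < e / 2]).
  split=> /=; first by exists d.
  by apply: near_eval; rewrite divr_gt0.
move=> [t zeta] /= [td zetad].
have lip (eta : types E n) : `|eta (t0 *: u + x) - eta (t *: u + x)| <= e / 4.
  apply: le_trans (types_lipschitz _ _ _) _.
  rewrite opprD addrACA subrr addr0 -scalerBl normu.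
  have -> : e / 4 = d * (`|b| + 1).
    by rewrite /d; field; rewrite gt_eqF.
  by apply: ler_pM => //; [exact: ltW|rewrite lerDl].
have := lip xi; have := lip zeta; move: zetad.
by rewrite ltr_norml !ler_norml /P ler_norml; lra.
Qed.

(** Flatness expresses differentiability of the semi-norm at [b]: by convexity
    the left-hand side is at least [2 * T * `|b|]. *)
Hypothesis flat : forall x e, 0 < e -> exists T,
  0 <= T /\ xi (T *: u + x) + xi (T *: u - x) <= 2 * T * `|b| + e.

Let lower zeta x t T : 0 <= T -> 0 <= t ->
  (t + T) * `|b| - zeta (T *: u - x) <= zeta (t *: u + x).
Proof.
move=> T0 t0; have := type_normD zeta (t *: u + x) (T *: u - x).
by rewrite addrACA subrr addr0 -scalerDl normu ger0_norm ?addr_ge0//; lra.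
Qed.

Let upper zeta x t T : T <= t ->
  zeta (t *: u + x) <= zeta (T *: u + x) + (t - T) * `|b|.
Proof.
move=> Tt; have := type_normD zeta ((t - T) *: u) (T *: u + x).
by rewrite addrA -scalerDl subrK normu ger0_norm ?subr_ge0//; lra.
Qed.

(** For [T <= t], [lower] and [upper] confine the values of [xi] and of [zeta] at
    [t u + x] to intervals determined by the values at [T u + x] and [T u - x];
    flatness makes these intervals short and closeness at the two points makes
    them overlap.  The case [t <= - T] follows by passing to [- x]. *)
Lemma near_line x e : 0 < e ->
  \forall zeta \near xi, forall t, `|xi (t *: u + x) - type_norm zeta (t *: u + x)| <= e.
Proof.
move=> e0; have e2 : 0 < e / 2 by rewrite divr_gt0.
have [T [T0 flatT]] := flat x e2.
near=> zeta; have zplus : `|xi (T *: u + x) - zeta (T *: u + x)| < e / 2.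
  by near: zeta; exact: near_eval.
have zminus : `|xi (T *: u - x) - zeta (T *: u - x)| < e / 2.
  by near: zeta; exact: near_eval.
have far y t : xi (T *: u + y) + xi (T *: u - y) <= 2 * T * `|b| + e / 2 ->
    `|xi (T *: u + y) - zeta (T *: u + y)| < e / 2 ->
    `|xi (T *: u - y) - zeta (T *: u - y)| < e / 2 ->
    T <= t -> `|xi (t *: u + y) - type_norm zeta (t *: u + y)| <= e.
  move=> flaty yplus yminus Tt; have t0 := le_trans T0 Tt.
  have := lower xi y T0 t0; have := upper xi y Tt.
  have := lower zeta y T0 t0; have := upper zeta y Tt.
  by move: yplus yminus; rewrite !ltr_norml ler_norml; lra.
have mid t : - T <= t <= T -> `|xi (t *: u + x) - type_norm zeta (t *: u + x)| <= e.
  by move: t; near: zeta; exact: near_segment.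
move=> t; have [Tt|tT] := leP T t; first exact: far.
have [tNT|NTt] := leP t (- T); last by apply: mid; rewrite !ltW.
rewrite -(typesN xi) -(typesN zeta) opprD -scaleNr.
by apply: far; rewrite ?opprK 1?addrC 1?lerNr// addrC.
Unshelve. all: end_near. Qed.

Lemma types_var_le zeta (l : 'rV[R]_n) :
  zeta (0, l) <= `|l| * \sum_(i < n) zeta (formal_var i).
Proof.
rewrite (formal_decomp (0, l)) add0r mulr_sumr.
elim/big_ind2: _ => [|p r q s pr qs|i _].
- by rewrite (sublinear0 (types_sublinear zeta)).
- by apply: le_trans (type_normD _ _ _) _; exact: lerD.
- rewrite type_normZ ler_wpM2r ?types_ge0//.
  by rewrite [leRHS]/Num.norm /= mx_normrE; apply: (le_bigmax_cond _ _ (j := (0, i))).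
Qed.

(** The types close to [xi] have a common Lipschitz constant in the coefficients
    of the variables, because their values at the variables are bounded; so
    [near_line] spreads over the compact unit ball of coefficients. *)
Lemma near_cube e : 0 < e ->
  \forall zeta \near xi, forall (l : 'rV[R]_n) t, `|l| <= 1 ->
    `|xi (t *: u + (0, l)) - type_norm zeta (t *: u + (0, l))| <= e.
Proof.
move=> e0; pose P zeta (l : 'rV[R]_n) :=
  forall t, `|xi (t *: u + (0, l)) - type_norm zeta (t *: u + (0, l))| <= e.
suff: \forall zeta \near xi, [set l : 'rV[R]_n | `|l| <= 1] `<=` P zeta.
  by apply: filterS => zeta zP l t l1; exact: zP.
have cpt : compact [set l : 'rV[R]_n | `|l| <= 1].
  apply: bounded_closed_compact.
    by exists 1; split=> // M M1 l /= l1; apply: le_trans l1 (ltW M1).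
  apply: (@closed_comp _ _ (fun l : 'rV[R]_n => `|l|) [set r | r <= 1]).
    by move=> l _; exact: norm_continuous.
  exact: closed_le.
move/compact_near_coveringP: cpt => cover; apply: (cover _ (nbhs xi) P) => l0 _.
pose m := \sum_(i < n) (xi (formal_var i) + 1).
have m0 : 0 <= m by apply: sumr_ge0 => i _; rewrite addr_ge0 ?types_ge0.
have m1 : 0 < m + 1 by rewrite ltr_wpDl.
pose d := e / (4 * (m + 1)); have d0 : 0 < d by rewrite divr_gt0// mulr_gt0.
near=> l zeta => t.
have zm i : `|xi (formal_var i) - zeta (formal_var i)| < 1.
  by move: i; near: zeta; apply: filter_forall => i; exact: near_eval.
have ld : `|l0 - l| <= d.
  by near: l; apply: (@cvgr_dist_le _ _ _ _ _ id) => //; exact: cvg_id.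
have z0 : `|xi (t *: u + (0, l0)) - zeta (t *: u + (0, l0))| <= e / 2.
  by move: t; near: zeta; apply: near_line; rewrite divr_gt0.
have lip (eta : types E n) : (forall i, eta (formal_var i) <= xi (formal_var i) + 1) ->
    `|eta (t *: u + (0, l0)) - eta (t *: u + (0, l))| <= e / 4.
  move=> eta_le; apply: le_trans (types_lipschitz _ _ _) _.
  rewrite opprD addrACA subrr add0r.
  have -> : (0, l0) - (0, l) = (0, l0 - l) :> formal.
    by apply: injective_projections; rewrite //= subr0.
  apply: le_trans (types_var_le _ _) _.
  have -> : e / 4 = d * (m + 1) by rewrite /d; field; rewrite gt_eqF.
  apply: ler_pM => //; first by apply: sumr_ge0 => i _; exact: types_ge0.
  by rewrite ler_wpDr//; apply: ler_sum.
have lip_xi : `|xi (t *: u + (0, l0)) - xi (t *: u + (0, l))| <= e / 4.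
  by apply: lip => i; rewrite lerDl.
have lip_zeta : `|zeta (t *: u + (0, l0)) - zeta (t *: u + (0, l))| <= e / 4.
  by apply: lip => i; have := zm i; rewrite ltr_norml; lra.
by move: z0 lip_xi lip_zeta; rewrite !ler_norml; lra.
Unshelve. all: end_near. Qed.

Hypothesis spanning : forall c : E, exists t, c = t *: b.

(** Homogeneity reduces the estimate to coefficients of norm one. *)
Lemma near_close e : 0 < e -> \forall zeta \near xi, close_types xi zeta e.
Proof.
move=> e0; apply: filterS (near_cube e0) => zeta cube [c l] /=.
have [l0|l0] := eqVneq l 0.
  by rewrite l0 !type_norm_extends subrr !normr0 mulr0.
have nl : 0 < `|l| by rewrite normr_gt0.
have [t ct] := spanning (`|l|^-1 *: c).
have -> : (c, l) = `|l| *: (t *: u + (0, `|l|^-1 *: l)) :> formal.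
  apply: injective_projections => /=.
    by rewrite addr0 -ct scalerA divff ?gt_eqF// scale1r.
  by rewrite scaler0 add0r scalerA divff ?gt_eqF// scale1r.
rewrite !type_normZ -mulrBr normrM !normr_id mulrC ler_wpM2r//.
by apply: cube; rewrite normrZ normfV normr_id mulVf// gt_eqF.
Qed.

Lemma flat_isolated : isolated_type xi.
Proof.
move=> U [r r0 rU]; have r2 : 0 < r / 2 by rewrite divr_gt0.
apply: filterS (near_close r2) => zeta close; apply: rU => /=.
apply: le_lt_trans (type_dist_le (ltW r2) close) _.
by rewrite lte_fin; lra.
Qed.

End flatness.

(** * Smooth vectors *)

Section smoothness.
Set Implicit Arguments.
Unset Strict Implicit.
Local Open Scope classical_set_scope.
Context {R : realType} {E : completeNormedModType R}.
Implicit Types (v x : E) (f g : {scalar E}).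

Lemma norm_sublinear : sublinear (fun x : E => `|x|).
Proof. by split=> [|t x t0]; [exact: ler_normD|rewrite normrZ ger0_norm]. Qed.

Lemma scalar_norm_le f x : (forall y, f y <= `|y|) -> `|f x| <= `|x|.
Proof. by move=> fle; rewrite ler_norml fle andbT lerNl -linearN -normrN fle. Qed.

Lemma norming_functionalP v f : v != 0 ->
  norming_functional v f <-> (forall x, f x <= `|x|) /\ f v = `|v|.
Proof.
move=> v0; have nv : 0 < `|v| by rewrite normr_gt0.
split=> [[_ _ f1 fv]|[fle fv]].
  split=> // x; pose D := [set `|f x| | x in [set x : E | `|x| <= 1]].
  (* Suprema of unbounded sets are [0] by convention, so dual norm [1] makes
     [D] bounded. *)
  have [D0 Db] : has_sup D.
    by apply: contrapT => /sup_out D0; move: f1; rewrite /dual_norm D0; lra.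
  have [->|x0] := eqVneq x 0; first by rewrite linear0 normr0.
  have nx : 0 < `|x| by rewrite normr_gt0.
  have : `|f (`|x|^-1 *: x)| <= sup D.
    apply: ub_le_sup => //; exists (`|x|^-1 *: x) => //=.
    by rewrite normrZ normfV normr_id mulVf// gt_eqF.
  rewrite [sup D]f1 linearZ /= normrM normfV normr_id mulrC ler_pdivrMr// mul1r.
  exact: le_trans (ler_norm _).
split=> //; first by move=> t x y; rewrite linearP.
  move=> x; apply/cvgrPdist_lt => e e0; near=> y.
  rewrite -linearB; apply: le_lt_trans (scalar_norm_le _ fle) _.
  by near: y; apply: (@cvgr_dist_lt _ _ _ _ _ id) => //; exact: cvg_id.
have ub1 : ubound [set `|f x| | x in [set x : E | `|x| <= 1]] 1.
  by move=> _ [x /= x1 <-]; exact: le_trans (scalar_norm_le _ fle) x1.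
have mem1 : [set `|f x| | x in [set x : E | `|x| <= 1]] 1.
  exists (`|v|^-1 *: v) => /=.
    by rewrite normrZ normfV normr_id mulVf// gt_eqF.
  by rewrite linearZ /= fv mulVf ?gt_eqF// normr1.
apply/eqP; rewrite eq_le; apply/andP; split; first by apply: ge_sup => //; exists 1.
by apply: ub_le_sup => //; exists 1.
Unshelve. all: end_near. Qed.

Lemma norming_scalar v (lam : E -> R) : norming_functional v lam ->
  exists f, lam = f.
Proof.
move=> [lam_scalar _ _ _].
pose f : {scalar E} := HB.pack lam (GRing.isLinear.Build R E R *%R lam lam_scalar).
by exists f.
Qed.

(** Lowering the norm along the ray of [v] gives the slope at infinity
    [q x], the infimum of [`|x + t *: v| - t * `|v|].  Functionals below [q] are
    norming for [v]; if there is only one, then it computes both [q x] and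
    [q (- x)], whose sum therefore vanishes. *)
Lemma smooth_flat v x (e : R) : v != 0 -> smooth v -> 0 < e ->
  exists T, 0 <= T /\ `|T *: v + x| + `|T *: v - x| <= 2 * T * `|v| + e.
Proof.
move=> v0 [lam [_ lam_uniq]] e0.
have Cv := ray_below v norm_sublinear.
pose q := lowering (ray v `|v|) (fun x : E => `|x|).
have qs : sublinear q by exact: lowering_sublinear norm_sublinear Cv.
have norming f : (forall y, f y <= q y) -> norming_functional v f.
  move=> fq; apply/norming_functionalP => //; have fle y : f y <= `|y|.
    exact: le_trans (fq y) (lowering_le_id norm_sublinear Cv y).
  split=> //; apply/eqP; rewrite eq_le fle /= -lerN2 -linearN.
  apply: le_trans (fq _) _.
  have := lowering_le norm_sublinear Cv (- v) (ray_ray _ _).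
  by rewrite addNr normr0 sub0r.
have [f [fq fx]] := norming_exists x qs.
have [g [gq gx]] := norming_exists (- x) qs.
have fg : q x + q (- x) = 0.
  rewrite -fx -gx -(lam_uniq _ (norming _ fq)) (lam_uniq _ (norming _ gq)).
  by rewrite linearN /= subrr.
have e2 : 0 < e / 2 by rewrite divr_gt0.
have [_ [_ [[t [t0 -> ->]] tx]]] := lowering_lt norm_sublinear Cv x e2.
have [_ [_ [[s [s0 -> ->]] sx]]] := lowering_lt norm_sublinear Cv (- x) e2.
(* The difference [`|y + r *: v| - r * `|v|] is nonincreasing in [r], so one
   parameter serves both [x] and [- x]. *)
have step r T y : r <= T -> `|T *: v + y| <= `|y + r *: v| + (T - r) * `|v|.
  move=> rT; rewrite -[T in T *: v](subrK r) scalerDl -addrA [_ + y]addrC addrC.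
  by apply: le_trans (ler_normD _ _) _; rewrite normrZ ger0_norm// subr_ge0.
exists (Num.max t s); split; first by rewrite le_max t0.
have := step t (Num.max t s) x; have := step s (Num.max t s) (- x).
rewrite !le_max !lexx orbT => /(_ isT) h1 /(_ isT) h2.
by move: tx sx; rewrite -/q; lra.
Qed.

End smoothness.

(** * Shrunk types *)

Section shrinking.
Set Implicit Arguments.
Unset Strict Implicit.
Local Open Scope classical_set_scope.
Context {R : realType} {E : completeNormedModType R} {n : nat}.
Local Notation formal := (E * 'rV[R]_n)%type.
Variables (xi : types E n) (f : {scalar formal}).
Hypothesis f_base : forall b : E, `|f (b, 0)| = `|b|.

Variable c : R.
Hypotheses (c0 : 0 <= c) (c1 : c <= 1).

(** Scaling a type by [c < 1] spoils its values on [E]; the functional [f], which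
    has absolute value equal to the norm there, restores them.  In the dual
    picture, the unit ball is scaled and the points [f] and [- f] are put back. *)
Definition shrunk_norm (x : formal) : R := Num.max (c * xi x) `|f x|.

Fact shrunk_normD x y : shrunk_norm (x + y) <= shrunk_norm x + shrunk_norm y.
Proof.
rewrite ge_max; apply/andP; split.
  apply: (@le_trans _ _ (c * xi x + c * xi y)).
    by rewrite -mulrDr ler_wpM2l// type_normD.
  by rewrite lerD// le_max lexx.
rewrite linearD; apply: le_trans (ler_normD _ _) _.
by rewrite lerD// le_max lexx orbT.
Qed.

Fact shrunk_normZ (t : R) x : shrunk_norm (t *: x) = `|t| * shrunk_norm x.
Proof. by rewrite /shrunk_norm type_normZ linearZ /= normrM maxr_pMr// mulrCA. Qed.

Fact shrunk_norm_extends (b : E) : shrunk_norm (b, 0) = `|b|.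
Proof.
by rewrite /shrunk_norm type_norm_extends f_base; apply/max_idPr; rewrite ler_piMl.
Qed.

Definition shrunk : types E n := Types shrunk_normD shrunk_normZ shrunk_norm_extends.

End shrinking.

(** * Types over a line *)

Section realisation.
Set Implicit Arguments.
Unset Strict Implicit.
Context {R : realType} {E F : completeNormedModType R} (j : isometric_inclusion E F).
Context {n : nat} (a : 'I_n -> F).
Local Notation formal := (E * 'rV[R]_n)%type.

Definition realisation (x : formal) : F := j x.1 + \sum_(i < n) x.2 ord0 i *: a i.

Fact realisation_is_linear : linear realisation.
Proof.
move=> t x y; rewrite /realisation /= linearP scalerDr addrACA scaler_sumr.
rewrite -big_split; congr (_ + _); apply: eq_bigr => i _.
by rewrite !mxE scalerDl scalerA.
Qed.

HB.instance Definition _ :=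
  GRing.isLinear.Build R formal F *:%R realisation realisation_is_linear.

End realisation.

Section line_types.
Set Implicit Arguments.
Unset Strict Implicit.
Local Open Scope classical_set_scope.
Context {R : realType} {E : completeNormedModType R} (v : E).
Hypothesis v_neq0 : v != 0.

Fact generator_in_line : v \in in_line v.
Proof. by apply/asboolP; exists 1; rewrite scale1r. Qed.

Definition generator : line v := Line generator_in_line.

Lemma line_spanned (c : line v) : exists t, c = t *: generator.
Proof.
by case: c => c cl; have /asboolP[t ct] := cl; exists t; apply: val_inj.
Qed.

(** The seminorm of a realised type is the norm of a vector, so flatness of the
    type is flatness of the norm at [v]. *)
Lemma smooth_atomic : smooth v -> atomic_over (line_incl v).
Proof.
move=> sm n a; apply: (@flat_isolated _ _ _ _ generator); last exact: line_spanned.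
move=> x e e0; have [T [T0 flatT]] :=
  smooth_flat (realisation (line_incl v) a x) v_neq0 sm e0.
exists T; split=> //.
have tpE y : tp (line_incl v) a y = `|realisation (line_incl v) a y| by [].
have gen : realisation (line_incl v) a (generator, 0) = v.
  by rewrite /realisation /= big1 ?addr0// => i _; rewrite mxE scale0r.
by rewrite !tpE linearB linearD !linearZ /= gen.
Qed.

Section not_smooth.
Variables (f g : {scalar E}) (w : E).
Hypotheses (f_le : forall x, f x <= `|x|) (fv : f v = `|v|).
Hypotheses (g_le : forall x, g x <= `|x|) (gv : g v = `|v|).

Let a (_ : 'I_1) := w.
Let rho := realisation (line_incl v) a.
Let xi := tp (line_incl v) a.
Let F : {scalar (line v * 'rV[R]_1)%type} := f \o rho.

Let x t : (line v * 'rV[R]_1)%type := (t *: generator, const_mx 1).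

Let rhox t : rho (x t) = t *: v + w.
Proof. by rewrite /rho /realisation /= big_ord1 mxE scale1r. Qed.

Let F_le y : `|F y| <= xi y.
Proof. exact: scalar_norm_le. Qed.

Let F_base (b : line v) : `|F (b, 0)| = `|b|.
Proof.
have [t ->] := line_spanned b.
rewrite /F /rho /= /realisation /= big1 ?addr0; last by move=> i _; rewrite mxE scale0r.
by rewrite linearZ /= fv norm_line /= normrM normrZ normr_id.
Qed.

Let c k : R := 1 - k.+1%:R^-1.
Let c0 k : 0 <= c k. Proof. by rewrite subr_ge0 invf_le1// ler1n. Qed.
Let c1 k : c k <= 1. Proof. by rewrite gerBl. Qed.
Let zeta k := shrunk xi F_base (c0 k) (c1 k).

Let zeta_cvg : zeta @ \oo --> xi.
Proof.
apply/types_cvg => y; apply: (@squeeze_cvgr _ _ _ _ (fun k => c k * xi y) (cst (xi y))).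
- near=> k; rewrite /= /shrunk_norm le_max lexx /= ge_max F_le andbT.
  exact: ler_piMl (types_ge0 xi y) (c1 k).
- rewrite -[X in _ --> X]mul1r; apply: cvgM; last exact: cvg_cst.
  rewrite -[X in _ --> X]subr0.
  by apply: cvgB; [exact: cvg_cst|exact: cvg_harmonic].
- exact: cvg_cst.
Unshelve. all: end_near. Qed.

(** The distance from [xi] to [zeta k] stays at least [g w - f w]: at [t v + w]
    the second term of the maximum defining [zeta k] wins as soon as
    [(1 - c k) * t * `|v|] reaches [2 * `|w|]. *)
Lemma not_isolated : f w < g w -> ~ isolated_type xi.
Proof.
move=> fg iso; pose r := (g w - f w) / 2.
have [k _ /(_ k (leqnn k))] : \forall k \near \oo, (type_dist xi (zeta k) < r%:E)%E.
  apply: (zeta_cvg (iso [set eta | (type_dist xi eta < r%:E)%E] _)).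
  by exists r => //; rewrite divr_gt0// subr_gt0.
pose t := 2 * `|w| * k.+1%:R / `|v|.
have nv : 0 < `|v| by rewrite normr_gt0.
move=> /= /type_dist_lt_le-/(_ (x t)); rewrite big_ord1 mxE normr1 mulr1.
have tv : t * `|v| = 2 * `|w| * k.+1%:R by rewrite /t divfK// gt_eqF.
have k1 : 1 <= k.+1%:R :> R by rewrite ler1n.
have w0 := normr_ge0 w.
have t0 : 0 <= t by rewrite divr_ge0// mulr_ge0// mulr_ge0.
have fw : `|f w| <= `|w| by exact: scalar_norm_le.
have wk : `|w| <= `|w| * k.+1%:R by rewrite ler_peMr.
have xiE : xi (x t) = `|t *: v + w| by rewrite -rhox.
have FE : F (x t) = t * `|v| + f w.
  by rewrite -[F _]/(f (rho _)) rhox linearD linearZ /= fv.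
have xi_ge : t * `|v| + g w <= xi (x t).
  by rewrite xiE; apply: le_trans (g_le _); rewrite linearD linearZ /= gv.
have -> : zeta k (x t) = t * `|v| + f w.
  rewrite [LHS]/(Num.max (c k * xi (x t)) `|F (x t)|) FE xiE.
  have tvf : 0 <= t * `|v| + f w by rewrite tv; move: fw; rewrite ler_norml; lra.
  rewrite ger0_norm//; apply/max_idPr.
  apply: (@le_trans _ _ (c k * (t * `|v| + `|w|))).
    rewrite ler_wpM2l//; apply: le_trans (ler_normD _ _) _.
    by rewrite normrZ ger0_norm.
  have ck : c k * (t * `|v|) = t * `|v| - 2 * `|w|.
    by rewrite tv /c mulrBl mul1r mulrCA mulVf ?mulr1// pnatr_eq0.
  have : c k * `|w| <= `|w| by rewrite ler_piMl.
  by rewrite mulrDr ck; move: fw; rewrite ler_norml; lra.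
rewrite /r; lra.
Qed.

End not_smooth.

Lemma atomic_smooth : atomic_over (line_incl v) -> smooth v.
Proof.
move=> at_v; have [f [f_le fv]] := norming_exists v (@norm_sublinear R E).
exists f; split=> [|_ /[dup] /norming_scalar[g ->]]; first exact/norming_functionalP.
move=> /norming_functionalP -/(_ v_neq0)[g_le gv]; apply/funext => w.
have [fg|gf|//] := ltgtP (f w) (g w).
  by case: (not_isolated f_le fv g_le gv fg); exact: at_v.
by case: (not_isolated g_le gv f_le fv gf); exact: at_v.
Qed.

End line_types.

Theorem proposition3p2 (R : realType) (E : completeNormedModType R) (v : E)
    (v_neq0 : v != 0) : atomic_over (line_incl v) <-> smooth v.
Proof. by split; [exact: atomic_smooth|exact: smooth_atomic]. Qed.
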